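(* Consider, for each $p$, the model $Y = X\beta^\star + Z$ described in the context, with $\beta^\star \in \mathcal{B}_{p,s}$ and the estimator $\hat\beta \in \arg\min_{\beta \in \mathcal{B}_{p,s}} \|Y - X\beta\|_2^2$. Fix $\delta \in (0,1)$. 1. If $s = o(p)$ and $s \to +\infty$ as $p \to +\infty$, set $n^\star := 2 s \log(p/s)$. 2. If $s = \alpha p$ for some constant $\alpha \in (0,1)$, set $n^\star := 2 h(\alpha) p$. In both settings, if there exists $\varepsilon > 0$ such that (for all sufficiently large $p$) $$ n_1 \log\left(1 + \frac{\delta (2\sigma_2^2 - \sigma_1^2) s}{2\sigma_2^4}\right) + n_2 \log\left(1 + \frac{\delta s}{2\sigma_2^2}\right) \ge (1+\varepsilon) n^\star, $$ then $$ \mathbb{P}\Big( |\operatorname{supp}(\beta^\star) \,\triangle\, \operatorname{supp}(\hat\beta)| < 2\delta s \Big) \ge 1 - \exp\{-(\varepsilon + o(1)) n^\star/2\} \xrightarrow{p\to+\infty} 1 .$$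
   Context: All quantities may depend on $p$, and asymptotics are as $p \to +\infty$. Sample sizes $n_1, n_2 \ge 1$, $n = n_1 + n_2$. The design $X \in \mathbb{R}^{n\times p}$ has i.i.d. $\mathcal{N}(0,1)$ entries. Noise levels satisfy $0 < \sigma_1^2 < \sigma_2^2$; $\Sigma = \begin{pmatrix} \sigma_1 I_{n_1} & 0 \\ 0 & \sigma_2 I_{n_2}\end{pmatrix}$, $W \sim \mathcal{N}(0, I_n)$ independent of $X$, and $Z = \Sigma W$ (so the first $n_1$ observations have noise variance $\sigma_1^2$ and the last $n_2$ have variance $\sigma_2^2$). The signal $\beta^\star$ is deterministic and belongs to $\mathcal{B}_{p,s} := \{\beta \in \{0,1\}^p : \|\beta\|_0 = s\}$, where $\|\beta\|_0$ is the number of nonzero coordinates. $\operatorname{supp}(\beta) = \{i : \beta_i \neq 0\}$, $A \triangle B = (A\cup B)\setminus(A\cap B)$. $h(x) = -x\log x - (1-x)\log(1-x)$ is the binary entropy (natural logarithm). The estimator $\hat\beta$ is any minimizer (it does not use knowledge of $\sigma_1,\sigma_2,n_1,n_2$). *)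

(* Defs.v *)
From HB Require Import structures.
From mathcomp Require Import all_boot all_order all_algebra.
From mathcomp Require Import all_classical all_reals all_analysis.
From mathcomp Require Import normal_distribution.
Set Implicit Arguments. Unset Strict Implicit. Unset Printing Implicit Defensive.
Import Order.TTheory GRing.Theory Num.Theory.
Import numFieldNormedType.Exports.
Local Open Scope classical_set_scope.
Local Open Scope ring_scope.

Section defs.
Context (R : realType).

Definition bin_entropy (x : R) : R := - x * ln x - (1 - x) * ln (1 - x).

Definition supp (p : nat) (b : 'cV[R]_p) : {set 'I_p} := [set i | b i 0 != 0].

Definition in_B (p s : nat) (b : 'cV[R]_p) : Prop :=
  (forall i, b i 0 = 0 \/ b i 0 = 1) /\ #|supp b| = s.

Definition symdiff_card (p : nat) (A B : {set 'I_p}) : nat :=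
  #|(A :\: B) :|: (B :\: A)|.

(* Sigma = diag(sig1 I_{n1}, sig2 I_{n2}) applied to W *)
Definition noise (n1 n2 : nat) (sig1 sig2 : R) (w : 'cV[R]_(n1 + n2))
  : 'cV[R]_(n1 + n2) :=
  \col_i ((if (i < n1)%N then sig1 else sig2) * w i 0).

Definition response (n1 n2 p : nat) (sig1 sig2 : R) (X : 'M[R]_(n1 + n2, p))
  (bstar : 'cV[R]_p) (w : 'cV[R]_(n1 + n2)) : 'cV[R]_(n1 + n2) :=
  X *m bstar + noise sig1 sig2 w.

Definition loss (n p : nat) (Y : 'cV[R]_n) (X : 'M[R]_(n, p)) (b : 'cV[R]_p) : R :=
  \sum_(i < n) (Y i 0 - (X *m b) i 0) ^+ 2.

Definition is_minimizer (n p s : nat) (Y : 'cV[R]_n) (X : 'M[R]_(n, p))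
  (b : 'cV[R]_p) : Prop :=
  in_B s b /\ forall b', in_B s b' -> loss Y X b <= loss Y X b'.

Section prob.
Context (d : measure_display) (T : measurableType d) (P : probability T R).

Definition mutually_independent (I : finType) (f : I -> T -> R) : Prop :=
  (forall i, measurable_fun setT (f i)) /\
  forall (J : {set I}) (B : I -> set R), (forall i, measurable (B i)) ->
    P (\bigcap_(i in [set` J]) (f i @^-1` B i)) =
    (\prod_(i in J) P (f i @^-1` B i))%E.

Definition std_gaussian (f : T -> R) : Prop :=
  forall B, measurable B -> P (f @^-1` B) = normal_prob 0 1 B.

(* X has i.i.d. N(0,1) entries, W ~ N(0, I_n), W independent of X:
   all entries of X and W are mutually independent standard Gaussians *)
Definition gaussian_design (n p : nat) (X : T -> 'M[R]_(n, p))
  (W : T -> 'cV[R]_n) : Prop :=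
  let f (k : ('I_n * 'I_p) + 'I_n) : T -> R :=
    match k with
    | inl ij => fun t => X t ij.1 ij.2
    | inr i => fun t => W t i 0
    end in
  mutually_independent f /\ forall k, std_gaussian (f k).

End prob.

Definition regime (s : nat -> nat) (nstar : nat -> R) : Prop :=
  ( (fun p => (s p)%:R / p%:R : R) @ \oo --> (0 : R) /\
    (fun p => ((s p)%:R : R)) @ \oo --> +oo /\
    nstar = (fun p => 2 * (s p)%:R * ln (p%:R / (s p)%:R)) )
  \/
  (exists alpha : R, 0 < alpha < 1 /\
    (fun p => (s p)%:R / p%:R : R) @ \oo --> alpha /\
    nstar = (fun p => 2 * bin_entropy alpha * p%:R)).

End defs.

(* Main.v *)
Require Import Defs.
From HB Require Import structures.
From mathcomp Require Import all_boot all_order all_algebra.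
From mathcomp Require Import all_classical all_reals all_analysis.
From mathcomp Require Import normal_distribution measurable_realfun.
From mathcomp Require Import ring lra.

(* For a competitor b at squared distance M = |symdiff| from
   b*, the event loss b <= loss b* says that sum_i (- g_i^2 - 2 g_i z_i) >= 0
   with g = X (b* - b) and z the noise. Chernoff's bound with parameter
   theta = 1 / (4 sig2^2), which does not depend on b, gives the probability
     prod_i (1 + 2 M theta (1 - 2 theta sigma_i^2))^(-1/2),
   and for M = 2 delta s these factors are exactly the arguments of the two
   logarithms of the hypothesis. The Gaussian expectation is computed by
   integrating out one entry of (X, W) at a time: conditioning on the other
   entries is a Fubini argument on the product of R with the sigma-algebra they
   generate. A union bound over the C(p, s) <= exp (p h(s / p)) supports loses a
   factor exp ((1 + o(1)) nstar / 2) in both regimes. *)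

Set Implicit Arguments.
Unset Strict Implicit.
Unset Printing Implicit Defensive.

Import Order.TTheory GRing.Theory Num.Theory.
Import numFieldNormedType.Exports.
Local Open Scope classical_set_scope.
Local Open Scope ring_scope.

(** * Gaussian integrals of exponentials of quadratic polynomials *)

Section gaussian_integral.
Context (R : realType).
Notation mu := (@lebesgue_measure R).

(** The Radon-Nikodym derivative of the normal law and [normal_pdf] have the same integral over
    every measurable set, hence agree almost everywhere. *)
Lemma ge0_integral_normal_prob (m s : R) (f : R -> \bar R) :
  (forall x, 0 <= f x)%E -> measurable_fun setT f ->
  (\int[normal_prob m s]_x f x = \int[mu]_x (f x * (normal_pdf m s x)%:E))%E.
Proof.
move=> f0 mf; have dom := normal_prob_dominates m s.
rewrite -(Radon_Nikodym_SigmaFinite.change_of_variables dom)//.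
have mRN := measurable_int _ (Radon_Nikodym_SigmaFinite.f_integrable dom).
apply: ae_eq_integral => //.
- exact: emeasurable_funM.
- apply: emeasurable_funM => //.
  by apply/measurable_EFinP; exact: measurable_normal_pdf.
- apply: ae_eqe_mul2l; apply: integral_ae_eq => //.
  + exact: Radon_Nikodym_SigmaFinite.f_integrable.
  + by apply/measurable_EFinP; exact: measurable_normal_pdf.
  + by move=> E _ mE; rewrite -Radon_Nikodym_SigmaFinite.f_integral.
Qed.

(* The odd shapes are those of the exponents in normal_fun. *)
Lemma complete_square (a b x q v : R) : q = 1 + 2 * a -> q != 0 -> v = q^-1 ->
  b * x - a * x ^+ 2 + - (x - 0) ^+ 2 / (1 ^+ 2 *+ 2) =
  b ^+ 2 / (2 * q) + - (x - b / q) ^+ 2 / (v *+ 2).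
Proof.
move=> qE q0 ->; rewrite expr1n subr0.
have -> : a = (q - 1) / 2 by rewrite qE; field.
by field.
Qed.

(* Completing the square turns the integrand into a multiple of the density of
   N(b / (1 + 2 a), 1 / (1 + 2 a)). *)
Lemma integral_normal_prob_expR_quad (a b : R) : 0 < 1 + 2 * a ->
  (\int[normal_prob 0 1]_x (expR (b * x - a * x ^+ 2))%:E =
   ((Num.sqrt (1 + 2 * a))^-1 * expR (b ^+ 2 / (2 * (1 + 2 * a))))%:E)%E.
Proof.
move=> a0; set q := 1 + 2 * a in a0 *.
have sq0 : 0 < Num.sqrt q by rewrite sqrtr_gt0.
set v := (Num.sqrt q)^-1.
have v0 : v != 0 by rewrite invr_eq0 gt_eqF.
have v2 : v ^+ 2 = q^-1 by rewrite exprVn sqr_sqrtr// ltW.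
rewrite ge0_integral_normal_prob; last 2 first.
- by move=> x; rewrite lee_fin expR_ge0.
- apply/measurable_EFinP; apply: measurableT_comp => //.
  by apply: measurable_funB => //; apply: measurable_funM.
transitivity (\int[mu]_x ((v * expR (b ^+ 2 / (2 * q)))%:E *
    (normal_pdf (b / q) v x)%:E))%E.
  apply: eq_integral => x _; rewrite -!EFinM; congr EFin.
  rewrite !normal_pdfE ?oner_eq0//.
  (* Passing from standard deviation 1 to [v] rescales the peak, which produces the factor [v] of
     the result. *)
  have -> : normal_peak (1 : R) = v * normal_peak v.
    rewrite /normal_peak v2 expr1n mul1r.
    rewrite -mulrnAr sqrtrM ?invr_ge0 ?ltW// sqrtrV ?ltW// -/v invfM mulrA.
    by rewrite divff ?mul1r.
  rewrite /normal_fun.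
  have sqE : expR (b * x - a * x ^+ 2) * expR (- (x - 0) ^+ 2 / (1 ^+ 2 *+ 2)) =
      expR (b ^+ 2 / (2 * q)) * expR (- (x - b / q) ^+ 2 / (v ^+ 2 *+ 2)).
    by rewrite -!expRD (@complete_square _ _ x q (v ^+ 2))// gt_eqF.
  move: sqE; move: (expR _) (expR _) (expR _) (expR _) (normal_peak v).
  move=> A B C E F sqE.
  by rewrite mulrCA sqE mulrACA.
rewrite ge0_integralZl//.
- by rewrite integral_normal_pdf mule1.
- by apply/measurable_EFinP; exact: measurable_normal_pdf.
- by move=> x _; rewrite lee_fin normal_pdf_ge0.
- by rewrite lee_fin mulr_ge0 ?expR_ge0// invr_ge0 ltW.
Qed.

End gaussian_integral.

(** * Conditioning on a sigma-algebra by Fubini *)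

Section conditioning.
Context {R : realType} {d : measure_display} {T : measurableType d}.
Variable P : probability T R.

(** Independence says that the law of [t |-> (x t, t)] on the product of [T1] with [T], the latter
    carrying only the sigma-algebra generated by [G], is a product measure; Tonelli then applies. *)
Lemma independent_integral_fubini d1 (T1 : measurableType d1)
    (N : probability T1 R) (x : T -> T1)
    (G : set (set T)) (F : T1 * g_sigma_algebraType G -> \bar R) :
  measurable_fun setT x -> G `<=` measurable -> setI_closed G -> G setT ->
  (forall A B, measurable A -> G B -> P (x @^-1` A `&` B) = N A * P B)%E ->
  measurable_fun setT F -> (forall z, 0 <= F z)%E ->
  (\int[P]_t F (x t, t) = \int[P]_t \int[N]_y F (y, t))%E.
Proof.
move=> mx Gm GI GT indep mF F0.
pose T0 : measurableType _ := g_sigma_algebraType G.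
have mid : measurable_fun setT (id : T -> T0).
  move=> _ A mA; rewrite setTI preimage_id.
  by apply: (smallest_sub _ Gm) mA; exact: sigma_algebra_measurable.
have mpair : measurable_fun setT ((fun t => (x t, t)) : T -> T1 * T0).
  exact: measurable_fun_pair.
pose idRV : {mfun T >-> T0} :=
  HB.pack (id : T -> T0) (isMeasurableFun.Build _ _ _ _ _ mid).
pose pairRV : {mfun T >-> (T1 * T0)%type} :=
  HB.pack ((fun t => (x t, t)) : T -> T1 * T0)
    (isMeasurableFun.Build _ _ _ _ _ mpair).
pose Q : probability T0 R := distribution P idRV.
pose J : probability (T1 * T0)%type R := distribution P pairRV.
(* Rectangles with second side in [G] form a pi-system; once shown to generate the product
   sigma-algebra, it determines the joint law. *)
pose C : set (set (T1 * T0)) := [set A `*` B | A in measurable & B in G].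
have CE : @measurable _ (T1 * T0)%type = <<s C >>.
  apply/seteqP; split; last first.
    apply: smallest_sub; first exact: sigma_algebra_measurable.
    move=> _ [A mA [B GB <-]]; apply: measurableX => //.
    exact: sub_sigma_algebra.
  rewrite measurable_prod_measurableType; apply: smallest_sub.
    exact: smallest_sigma_algebra.
  move=> _ [A mA [B mB <-]].
  (* Good-sets argument: for fixed [A], the admissible second sides form a sigma-algebra containing
     [G]. *)
  pose S := [set B | <<s C >> (A `*` B)].
  suff: <<s G >> `<=` S by apply.
  apply: smallest_sub; last first.
    by move=> B' GB'; apply: sub_sigma_algebra; exists A => //; exists B'.
  split => [|D SD|D SD].
  - by rewrite /S/= setX0; exact: sigma_algebra0.
  - rewrite /S /= setTD.
    (* The full strip over [A] is itself a rectangle of [C], because [G] contains the whole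
       space. *)
    have -> : A `*` ~` D = (A `*` setT) `\` (A `*` D).
      apply/seteqP; split=> -[u v]/=; [by move=> [? ?]; split => // -[]|].
      by move=> [[Au _] nD]; split => // Dv; apply: nD.
    apply: (@measurableD _ (g_sigma_algebraType C)) => //.
    by apply: sub_sigma_algebra; exists A => //; exists setT.
  - by rewrite /S /= setX_bigcupr; exact: sigma_algebra_bigcup.
have JE A : measurable A -> (N \x Q)%E A = J A.
  move=> mA; apply: (@measure_unique _ R _ C (fun=> setT) CE) => //.
  - move=> _ _ [A1 mA1 [B1 GB1 <-]] [A2 mA2 [B2 GB2 <-]].
    rewrite -setXI; exists (A1 `&` A2); first exact: measurableI.
    by exists (B1 `&` B2) => //; exact: GI.
  - by move=> _; exists setT => //; exists setT => //; rewrite setXTT.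
  - by rewrite bigcup_const.
  - move=> _ [A1 mA1 [B1 GB1 <-]].
    rewrite [LHS](product_measure1E N Q)//=; last exact: sub_sigma_algebra.
    by rewrite /Q /J /distribution /pushforward/= -indep//.
  - move=> _; rewrite -setXTT [X in (X < _)%E](product_measure1E N Q)//=.
    rewrite probability_setT mul1e -[X in (X < _)%E]/(Q setT).
    by rewrite probability_setT ltry.
transitivity (\int[J]_z F z)%E.
  by rewrite ge0_integral_distribution.
transitivity (\int[N \x Q]_z F z)%E.
  by apply: eq_measure_integral => A mA _; apply/esym/JE.
rewrite fubini_tonelli2// /fubini_G /=.
rewrite ge0_integral_distribution//.
  exact: measurable_fun_fubini_tonelli_G.
by move=> t; apply: integral_ge0.
Qed.

End conditioning.

(** * Sigma-algebras generated by subfamilies of independent Gaussians *)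

Section boxes.
Context {R : realType} {d : measure_display} {T : measurableType d}.
Variable P : probability T R.
Variables (I : finType) (f : I -> T -> R).
Hypothesis find : mutually_independent P f.
Hypothesis fgauss : forall k, std_gaussian P (f k).
Implicit Types (J : {set I}) (k : I).

(** A pi-system generating the sigma-algebra of the [f i], [i] in [J]. The sets [B] are indexed by
    all of [I] to match [mutually_independent]. *)
Definition boxes J : set (set T) :=
  [set \bigcap_(i in [set` J]) (f i @^-1` B i) | B in
     [set B : I -> set R | forall i, measurable (B i)]].

(* Measurability with respect to the sigma-algebra generated by f_i, i in J. *)
Definition family_measurable J (h : T -> R) :=
  measurable_fun setT (h : g_sigma_algebraType (boxes J) -> R).

Lemma measurable_family k : measurable_fun setT (f k).
Proof. by case: find. Qed.

Lemma boxes_measurable J : boxes J `<=` measurable.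
Proof.
move=> _ [B mB <-]; apply: fin_bigcap_measurable => // i _.
by rewrite -[X in measurable X]setTI; exact: measurable_family.
Qed.

Lemma boxes_setI J : setI_closed (boxes J).
Proof.
move=> _ _ [B mB <-] [B' mB' <-]; exists (fun i => B i `&` B' i).
  by move=> i; exact: measurableI.
by rewrite -bigcapI.
Qed.

Lemma boxes_setT J : boxes J setT.
Proof. by exists (fun=> setT) => //; rewrite -subTset => t _ i _. Qed.

Lemma boxes_subset J J' : J \subset J' -> boxes J `<=` boxes J'.
Proof.
move=> /fintype.subsetP JJ' _ [B mB <-].
exists (fun i => if i \in J then B i else setT) => [i /=|]; first by case: ifP.
apply/seteqP; split=> t /= Bt i /= Ji.
- by have := Bt i (JJ' _ Ji); rewrite /= Ji.
- by case: ifPn => //= iJ; exact: Bt.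
Qed.

(** Mutual independence over [k |: J], with [A] placed at coordinate [k], splits off one factor;
    independence over [J] recombines the others. *)
Lemma boxes_independent J k A C : k \notin J -> measurable A -> boxes J C ->
  P (f k @^-1` A `&` C) = (normal_prob 0 1 A * P C)%E.
Proof.
move=> kJ mA [B mB <-]; have [_ indep] := find.
pose B' i := if i == k then A else B i.
have B'J i : i \in J -> B' i = B i.
  by rewrite /B'; case: eqP => // ->; rewrite (negbTE kJ).
have := indep (k |: J) B'; rewrite big_setU1//= /B' eqxx fgauss//.
rewrite (eq_bigr (fun i => P (f i @^-1` B i))); last first.
  by move=> i iJ; rewrite -[X in f i @^-1` X]/(B' i) B'J.
rewrite -indep// => <-; last by move=> i; case: ifP.
congr (P _); apply/seteqP; split => t /=.
- move=> [At Bt] i /=; rewrite in_setU1; case: eqVneq => [-> //|_ /= iJ].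
  exact: Bt.
- move=> Bt; split; first by have := Bt k; rewrite /= in_setU1 eqxx/=; exact.
  move=> i /= iJ; have := Bt i; rewrite /= in_setU1 iJ orbT -/(B' i) B'J//.
  exact.
Qed.

Lemma family_measurable_mem J k : k \in J -> family_measurable J (f k).
Proof.
move=> kJ _ A mA; apply: sub_sigma_algebra.
exists (fun i => if i == k then A else setT) => [i /=|]; first by case: ifP.
rewrite setTI; apply/seteqP; split => t /=.
- by move=> /(_ k kJ); rewrite eqxx.
- by move=> At i _; case: eqVneq => [->|].
Qed.

Lemma family_measurable_subset J J' h : J \subset J' ->
  family_measurable J h -> family_measurable J' h.
Proof.
move=> JJ' mh _ A mA; have := mh measurableT A mA.
by apply: sub_sigma_algebra2; exact: boxes_subset.
Qed.

Lemma family_measurableW J h : family_measurable J h -> measurable_fun setT h.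
Proof.
move=> mh _ A mA; have := mh measurableT A mA; apply: smallest_sub.
  exact: sigma_algebra_measurable.
exact: boxes_measurable.
Qed.

(** Given the [f i] with [i] in [J], the values of [U] and [V] are frozen while [f k] is still
    standard normal, so the inner integral is the one-dimensional formula with [b = U t]. *)
Lemma integral_expR_gaussian J k (a : R) (U V : T -> R) :
  k \notin J -> family_measurable J U -> family_measurable J V ->
  (forall t, 0 <= V t) -> 0 < 1 + 2 * a ->
  (\int[P]_t (expR (U t * f k t - a * f k t ^+ 2) * V t)%:E =
   \int[P]_t ((Num.sqrt (1 + 2 * a))^-1 *
               (expR (U t ^+ 2 / (2 * (1 + 2 * a))) * V t))%:E)%E.
Proof.
move=> kJ mU mV V0 a0.
pose F (z : R * g_sigma_algebraType (boxes J)) :=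
  (expR (U z.2 * z.1 - a * z.1 ^+ 2) * V z.2)%:E.
have mF : measurable_fun setT F.
  apply/measurable_EFinP; apply: measurable_funM.
    apply: measurableT_comp => //; apply: measurable_funB.
      by apply: measurable_funM => //; exact: measurableT_comp.
    by apply: measurable_funM => //; exact: measurable_funX.
  exact: measurableT_comp.
transitivity (\int[P]_t F (f k t, t))%E; first by [].
rewrite (@independent_integral_fubini _ _ _ P _ _ (normal_prob 0 1))//.
- apply: eq_integral => t _ /=.
  transitivity (\int[normal_prob 0 1]_y
      ((expR (U t * y - a * y ^+ 2))%:E * (V t)%:E))%E.
    by apply: eq_integral => y _; rewrite -EFinM.
  rewrite ge0_integralZr//.
  + rewrite (integral_normal_prob_expR_quad _ a0) -EFinM.
    by rewrite mulrA.
  + apply/measurable_EFinP; apply: measurableT_comp => //.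
    apply: measurable_funB; first exact: measurable_funM.
    by apply: measurable_funM => //; exact: measurable_funX.
  + by rewrite lee_fin V0.
- exact: measurable_family.
- exact: boxes_measurable.
- exact: boxes_setI.
- exact: boxes_setT.
- by move=> A C mA BC; exact: boxes_independent BC.
- by move=> z; rewrite lee_fin mulr_ge0 ?expR_ge0.
Qed.

End boxes.

(** * Exponential moment of the square of a linear combination *)

Section rows.
Context {R : realType} {d : measure_display} {T : measurableType d}.
Variable P : probability T R.

Section linear_combination.
Variables (I : finType) (f : I -> T -> R).
Hypothesis find : mutually_independent P f.
Hypothesis fgauss : forall k, std_gaussian P (f k).

Lemma family_measurable_lincomb (J : {set I}) (K : Type) (phi : K -> I)
    (a : K -> R) (ks : seq K) :
  {subset map phi ks <= J} ->
  family_measurable f J (fun t => \sum_(k <- ks) a k * f (phi k) t).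
Proof.
elim: ks => [_|k ks IH sub].
  by under eq_fun do rewrite big_nil; exact: measurable_cst.
under eq_fun do rewrite big_cons.
apply: measurable_funD.
  apply: measurable_funM => //; apply: family_measurable_mem.
  by apply: sub; rewrite /= mem_head.
by apply: IH => i iks; apply: sub; rewrite /= in_cons iks orbT.
Qed.

(* Integrating out one Gaussian at a time replaces c by c / (1 + 2 c a_k^2),
   and the normalising factors telescope. *)
Lemma integral_expR_lincomb (J : {set I}) (K : eqType) (phi : K -> I)
    (a : K -> R) (V : T -> R) (ks : seq K) (c : R) :
  uniq (map phi ks) -> (forall k, k \in ks -> phi k \notin J) ->
  family_measurable f J V -> (forall t, 0 <= V t) -> 0 <= c ->
  (\int[P]_t (expR (- c * (\sum_(k <- ks) a k * f (phi k) t) ^+ 2) * V t)%:E =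
   (Num.sqrt (1 + 2 * c * \sum_(k <- ks) a k ^+ 2))^-1%:E *
   \int[P]_t (V t)%:E)%E.
Proof.
move=> + + mV V0; elim: ks c => [|k ks IH] c.
  move=> _ _ c0; rewrite big_nil mulr0 addr0 sqrtr1 invr1 mul1e.
  by apply: eq_integral => t _; rewrite big_nil expr0n mulr0 expR0 mul1r.
move=> /= /andP[kks uks] ksJ c0.
(* The variables that remain once [phi k] is integrated out: those of [V] and those of the tail of
   the sum. *)
pose J' := J :|: [set i in map phi ks].
have kJ' : phi k \notin J'.
  by rewrite !inE negb_or kks andbT ksJ ?mem_head.
pose S t := \sum_(k <- ks) a k * f (phi k) t.
have mS : family_measurable f J' S.
  by apply: family_measurable_lincomb => i iks; rewrite !inE iks orbT.
have mV' : family_measurable f J' V.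
  by apply: family_measurable_subset mV; exact: finset.subsetUl.
set q := 1 + 2 * (c * a k ^+ 2).
have q0 : 0 < q.
  by rewrite ltr_pwDl// mulr_ge0// mulr_ge0// sqr_ge0.
(* Expand the square of [a k * f (phi k) t + S t] and sort by powers of [f (phi k) t]. *)
transitivity (\int[P]_t (expR ((- 2 * c * a k * S t) * f (phi k) t -
   (c * a k ^+ 2) * f (phi k) t ^+ 2) * (expR (- c * S t ^+ 2) * V t))%:E)%E.
  apply: eq_integral => t _; rewrite big_cons mulrA -expRD -/(S t).
  by congr (EFin (expR _ * _)); ring.
rewrite (integral_expR_gaussian find fgauss kJ')//; last 3 first.
- by apply: measurable_funM => //.
- apply: measurable_funM => //; apply: measurableT_comp => //.
  by apply: measurable_funM => //; exact: measurable_funX.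
- by move=> t; rewrite mulr_ge0 ?expR_ge0.
rewrite -/q.
(* The exponents combine as [(2 c a_k S)^2 / (2 q) - c S^2 = - (c / q) S^2], since
   [q = 1 + 2 c a_k^2]. *)
transitivity (\int[P]_t ((Num.sqrt q)^-1%:E *
    (expR (- (c / q) * S t ^+ 2) * V t)%:E))%E.
  apply: eq_integral => t _; rewrite -EFinM; congr (EFin (_ * _)).
  rewrite mulrA -expRD; congr (expR _ * _); rewrite /q; field.
  by rewrite gt_eqF.
rewrite ge0_integralZl//; last 2 first.
- apply/measurable_EFinP; apply: (family_measurableW find (J := J')).
  apply: measurable_funM => //; apply: measurableT_comp => //.
  by apply: measurable_funM => //; exact: measurable_funX.
- by move=> t _; rewrite lee_fin mulr_ge0 ?expR_ge0.
rewrite IH//; last 2 first.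
- by move=> i iks; rewrite ksJ// in_cons iks orbT.
- by rewrite divr_ge0// ltW.
rewrite muleA -EFinM -invfM -sqrtrM ?ltW// big_cons.
congr ((Num.sqrt _)^-1%:E * _)%E.
rewrite mulrDr mulr1 /q; field.
by rewrite gt_eqF.
Qed.

End linear_combination.

End rows.

(** * Exponential moment of the loss difference, row by row *)

Section design.
Context {R : realType} {d : measure_display} {T : measurableType d}.
Variable P : probability T R.
Variables (n p : nat) (X : T -> 'M[R]_(n, p)) (W : T -> 'cV[R]_n).
Hypothesis XW : gaussian_design P X W.
Local Notation key := (('I_n * 'I_p) + 'I_n)%type.

(** The family inside [gaussian_design], named so that the results on independent families apply to
    it. *)
Definition design_entry (k : key) : T -> R :=
  match k with
  | inl ij => fun t => X t ij.1 ij.2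
  | inr i => fun t => W t i 0
  end.

Let row_of (k : key) : 'I_n := match k with inl ij => ij.1 | inr i => i end.

Let find : mutually_independent P design_entry.
Proof. exact: (proj1 XW). Qed.

Let fgauss k : std_gaussian P (design_entry k).
Proof. exact: (proj2 XW k). Qed.

Lemma measurable_designX i j : measurable_fun setT (fun t => X t i j).
Proof. exact: (measurable_family find (inl (i, j))). Qed.

Lemma measurable_designW i : measurable_fun setT (fun t => W t i 0).
Proof. exact: (measurable_family find (inr i)). Qed.

Variables (v : 'I_p -> R) (sg : 'I_n -> R) (theta : R).
Hypothesis theta0 : 0 <= theta.
Hypothesis thetasg : forall i, 2 * theta * sg i ^+ 2 <= 1.

(** For [v = bstar - b], the product of the [h i] over all rows is the exponential of [theta] times
    the loss of [bstar] minus the loss of [b]. *)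
Let g i t := \sum_(j < p) v j * X t i j.
Let h i t :=
  expR (- theta * g i t ^+ 2 - 2 * theta * sg i * g i t * W t i 0).

(** In each row the noise entry goes first, turning [- theta g^2] into
    [- theta (1 - 2 theta sg^2) g^2]; then the row of [X] is a Gaussian linear combination.
    [thetasg] keeps this last coefficient nonpositive. *)
Lemma integral_design_expR (rs : seq 'I_n) : uniq rs ->
  (\int[P]_t (\prod_(i <- rs) h i t)%:E =
   (\prod_(i <- rs) (Num.sqrt (1 + 2 * (theta * (1 - 2 * theta * sg i ^+ 2)) *
      \sum_(j < p) v j ^+ 2))^-1)%:E)%E.
Proof.
elim: rs => [_|i rs IH /= /andP[irs urs]].
  under eq_integral do rewrite big_nil.
  rewrite big_nil; transitivity (1%:E * P setT)%E; first exact: integral_cst.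
  by rewrite probability_setT mule1.
(* [J] holds the rows already treated by induction; [J'] adds row [i] of [X] but not its noise
   entry. *)
pose J : {set key} := [set k | row_of k \in rs]%SET.
pose J' : {set key} :=
  (J :|: [set k in [seq inl (i, j) | j <- index_enum 'I_p]])%SET.
have JJ' : J \subset J' by exact: finset.subsetUl.
have mg (I : {set key}) i' : (forall j, inl (i', j) \in I) ->
    family_measurable design_entry I (g i').
  move=> iI; apply: (family_measurable_lincomb (phi := fun j => inl (i', j))).
  by move=> k /mapP[j _ ->].
pose V t := \prod_(i <- rs) h i t.
have V0 t : 0 <= V t by rewrite prodr_ge0// => j _; rewrite expR_ge0.
have mV : family_measurable design_entry J V.
  apply: measurable_prod => i' i'rs; apply: measurableT_comp => //.
  have mg' : family_measurable design_entry J (g i').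
    by apply: mg => j; rewrite inE.
  apply: measurable_funB.
    by apply: measurable_funM => //; exact: measurable_funX.
  apply: measurable_funM => //; first exact: measurable_funM.
  by apply: (family_measurable_mem (k := inr i')); rewrite inE.
have mgi : family_measurable design_entry J' (g i).
  by apply: mg => j; rewrite !inE map_f ?orbT// mem_index_enum.
have iJ' : inr i \notin J'.
  rewrite !inE /= (negbTE irs) /=; apply/negP => /mapP[j _]; by [].
(* The exponent is linear in the noise, hence the quadratic coefficient 0. *)
transitivity (\int[P]_t (expR
    ((- 2 * theta * sg i * g i t) * design_entry (inr i) t -
     0 * design_entry (inr i) t ^+ 2) *
     (expR (- theta * g i t ^+ 2) * V t))%:E)%E.
  apply: eq_integral => t _; rewrite big_cons mulrA -expRD -/(V t).
  by congr (EFin (expR _ * _)); rewrite /=; ring.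
rewrite (integral_expR_gaussian find fgauss iJ')//; last 3 first.
- exact: measurable_funM.
- apply: measurable_funM.
    apply: measurableT_comp => //.
    by apply: measurable_funM => //; exact: measurable_funX.
  exact: family_measurable_subset mV.
- by move=> t; rewrite mulr_ge0 ?expR_ge0.
set c := theta * (1 - 2 * theta * sg i ^+ 2).
have c0 : 0 <= c by rewrite mulr_ge0// subr_ge0.
transitivity (\int[P]_t (expR (- c * g i t ^+ 2) * V t)%:E)%E.
  apply: eq_integral => t _; rewrite mulr0 addr0 sqrtr1 invr1 mul1r.
  rewrite mulrA -expRD.
  by congr (EFin (expR _ * _)); rewrite /c; field.
rewrite (@integral_expR_lincomb _ _ _ P _ _ find fgauss J _
   (fun j => inl (i, j)) v V (index_enum 'I_p))//; last 2 first.
- rewrite map_inj_uniq ?index_enum_uniq// => j j' [] //.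
- by move=> j _; rewrite inE.
by rewrite IH// -EFinM big_cons.
Qed.

End design.

(** * Finite union bound *)

Section union_bound.
Context {R : realType} {d : measure_display} {T : measurableType d}.
Variable P : probability T R.

Lemma union_bound (I : finType) (Q : pred I) (F : I -> set T) (c : R) :
  (forall i, measurable (F i)) -> (forall i, Q i -> (P (F i) <= c%:E)%E) ->
  (P (\big[setU/set0]_(i | Q i) F i) <= (#|Q|%:R * c)%:E)%E.
Proof.
move=> mF Fc; apply: (@le_trans _ _ (\sum_(i | Q i) c%:E)%E); last first.
  by rewrite sumEFin sumr_const mulr_natl.
rewrite -big_filter -[X in (_ <= X)%E]big_filter; set s := seq.filter _ _.
have : all Q s by rewrite filter_all.
elim: s => [_|i s IH /= /andP[Qi Qs]]; first by rewrite !big_nil measure0.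
rewrite !big_cons (le_trans (measureU2 _ _ _))//.
  exact: bigsetU_measurable.
by rewrite leeD ?Fc ?IH.
Qed.

End union_bound.

(** * Binary vectors and their supports *)

Section indicator.
Context {R : realType} (p : nat).

(** Identifies the binary vectors of sparsity [s] with the [s]-subsets of a finite type, over which
    unions and intersections are finite. *)
Definition indicator_col (A : {set 'I_p}) : 'cV[R]_p := \col_i (i \in A)%:R.

Lemma supp_indicator_col A : supp (indicator_col A) = A.
Proof.
by apply/setP => i; rewrite inE mxE; case: (i \in A); rewrite ?oner_eq0 ?eqxx.
Qed.

Lemma in_B_indicator_col s (A : {set 'I_p}) :
  #|A| = s -> in_B s (indicator_col A).
Proof.
move=> As; split; last by rewrite supp_indicator_col.
by move=> i; rewrite mxE; case: (i \in A); [right|left].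
Qed.

Lemma indicator_col_supp s (b : 'cV[R]_p) :
  in_B s b -> b = indicator_col (supp b).
Proof.
move=> [b01 _]; apply/colP => i; rewrite !mxE inE.
by case: (b01 i) => ->; rewrite ?eqxx// oner_eq0.
Qed.

(** The coordinates differ by 0 or by plus or minus 1, the latter exactly on the symmetric
    difference. *)
Lemma sum_sqr_sub_in_B s (b b' : 'cV[R]_p) : in_B s b -> in_B s b' ->
  \sum_(j < p) (b j 0 - b' j 0) ^+ 2 = (symdiff_card (supp b) (supp b'))%:R.
Proof.
move=> [b01 _] [b'01 _]; rewrite /symdiff_card -sum1_card natr_sum.
rewrite [RHS]big_mkcond/=.
apply: eq_bigr => j _; rewrite !inE.
by case: (b01 j) => ->; case: (b'01 j) => ->;
  rewrite ?eqxx ?oner_eq0/= ?subr0 ?sub0r ?sqrrN ?expr0n ?expr1n ?subrr ?expr0n.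
Qed.

End indicator.

Lemma invr_sqrt_expR {R : realType} (a : R) : 0 < a ->
  (Num.sqrt a)^-1 = expR (- (ln a / 2)).
Proof.
move=> a0; rewrite -powR12_sqrt ?ltW// /powR gt_eqF// -expRN.
by congr (expR (- _)); rewrite mulrC.
Qed.

(** * Chernoff and union bounds at fixed dimension *)

Section error_probability.
Context {R : realType} {d : measure_display} {T : measurableType d}.
Variable P : probability T R.
Variables (n1 n2 p s : nat) (sig1 sig2 : R) (bstar : 'cV[R]_p).
Variables (X : T -> 'M[R]_(n1 + n2, p)) (W : T -> 'cV[R]_(n1 + n2)).
Hypothesis sig12 : 0 < sig1 ^+ 2 < sig2 ^+ 2.
Hypothesis bstarB : in_B s bstar.
Hypothesis XW : gaussian_design P X W.
Variable delta : R.
Hypothesis delta0 : 0 <= delta.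

Let Y t := response sig1 sig2 (X t) bstar (W t).
Let sg (i : 'I_(n1 + n2)) := if (i < n1)%N then sig1 else sig2.
(** This value maximises [theta * (1 - 2 * theta * sig2 ^+ 2)], the coefficient of the noisier
    rows. *)
Let theta := (4 * sig2 ^+ 2)^-1.

Definition error_exponent : R :=
  n1%:R * ln (1 + delta * (2 * sig2 ^+ 2 - sig1 ^+ 2) * s%:R / (2 * sig2 ^+ 4))
  + n2%:R * ln (1 + delta * s%:R / (2 * sig2 ^+ 2)).

Lemma measurable_loss b : measurable_fun setT (fun t => loss (Y t) (X t) b).
Proof.
have mX := measurable_designX XW; have mW := measurable_designW XW.
apply: measurable_sum => i; apply: measurable_funX; apply: measurable_funB.
  under eq_fun do rewrite !mxE; apply: measurable_funD.
    by apply: measurable_sum => j; exact: measurable_funM.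
  exact: measurable_funM.
under eq_fun do rewrite !mxE.
by apply: measurable_sum => j; exact: measurable_funM.
Qed.

Lemma measurable_loss_le b b' :
  measurable [set t | loss (Y t) (X t) b <= loss (Y t) (X t) b'].
Proof.
rewrite -[X in measurable X]setTI.
by apply: measurable_fun_le => //; exact: measurable_loss.
Qed.

(** Chernoff's bound; its factors decrease with the squared distance, which may therefore be
    replaced by its lower bound [2 * delta * s]. *)
Lemma loss_le_prob b : in_B s b ->
  2 * delta * s%:R <= (symdiff_card (supp bstar) (supp b))%:R ->
  (P [set t | (loss (Y t) (X t) b <= loss (Y t) (X t) bstar)%R] <=
   (expR (- (error_exponent / 2)))%:E)%E.
Proof.
move=> bB bad; case/andP: sig12 => s10 s12.
have s20 : 0 < sig2 ^+ 2 := lt_trans s10 s12.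
have sig20 : sig2 != 0 by rewrite -sqrf_eq0 gt_eqF.
pose v j := bstar j 0 - b j 0.
pose g i t := \sum_(j < p) v j * X t i j.
pose h i t := expR (- theta * g i t ^+ 2 - 2 * theta * sg i * g i t * W t i 0).
have theta0 : 0 <= theta by rewrite invr_ge0 mulr_ge0// ltW.
have sgle i : sg i ^+ 2 <= sig2 ^+ 2
  by rewrite /sg; case: ifP => // _; exact: ltW.
have thetasg i : 2 * theta * sg i ^+ 2 <= 1.
  rewrite /theta.
  have -> : 2 * (4 * sig2 ^+ 2)^-1 * sg i ^+ 2 = (sg i ^+ 2 / sig2 ^+ 2) / 2.
    by field.
  have : sg i ^+ 2 / sig2 ^+ 2 <= 1 by rewrite ler_pdivrMr// mul1r.
  lra.
have := integral_design_expR XW v theta0 thetasg (index_enum_uniq 'I_(n1 + n2)).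
set E := [set t | _].
have mE : measurable E by exact: measurable_loss_le.
move=> intE.
(* On [E] the loss difference is nonnegative, so its exponential dominates the indicator of [E]. *)
have /le_trans : (P E <= \int[P]_t (\prod_(i < n1 + n2) h i t)%:E)%E.
  rewrite -[E]setIT -integral_indic//; apply: ge0_le_integral => //.
  - exact/measurable_EFinP/measurable_indic.
  - apply/measurable_EFinP; apply: measurable_prod => i _.
    have mg : measurable_fun setT (g i).
      apply: measurable_sum => j; apply: measurable_funM => //.
      exact: measurable_designX XW _ _.
    apply: measurableT_comp => //; apply: measurable_funB.
      by apply: measurable_funM => //; exact: measurable_funX.
    apply: measurable_funM; last exact: measurable_designW XW _.
    exact: measurable_funM.
  - move=> t _; rewrite lee_fin indicE.
    have [tE|_] := boolP (t \in E); last first.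
      by rewrite prodr_ge0// => i _; rewrite expR_ge0.
    have lossE : \sum_(i < n1 + n2)
          (- theta * g i t ^+ 2 - 2 * theta * sg i * g i t * W t i 0) =
        theta * (loss (Y t) (X t) bstar - loss (Y t) (X t) b).
      rewrite -sumrB mulr_sumr; apply: eq_bigr => i _.
      have -> : Y t i 0 = (X t *m bstar) i 0 + sg i * W t i 0 by rewrite !mxE.
      have -> : (X t *m b) i 0 = (X t *m bstar) i 0 - g i t.
        rewrite !mxE -sumrB; apply: eq_bigr => j _; rewrite /v; ring.
      ring.
    rewrite -expR_sum lossE -[leLHS]expR0 ler_expR mulr_ge0// subr_ge0.
    by move: tE; rewrite inE.
apply; rewrite intE lee_fin.
rewrite (sum_sqr_sub_in_B bstarB bB); set M := (symdiff_card _ _)%:R in bad *.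
(* The inverse square of the factor of row [i], at the smallest bad distance. *)
pose a i := 1 + 2 * (theta * (1 - 2 * theta * sg i ^+ 2)) * (2 * delta * s%:R).
have c0 i : 0 <= 2 * (theta * (1 - 2 * theta * sg i ^+ 2)).
  by rewrite mulr_ge0// mulr_ge0// subr_ge0.
have a0 i : 0 < a i by rewrite ltr_pwDl// mulr_ge0// !mulr_ge0.
apply: (@le_trans _ _ (\prod_(i < n1 + n2) expR (- (ln (a i) / 2)))).
  apply: ler_prod => i _; rewrite invr_ge0 sqrtr_ge0 -invr_sqrt_expR//=.
  rewrite lef_pV2 ?posrE ?sqrtr_gt0//.
    by rewrite ler_wsqrtr// lerD2l ler_wpM2l.
  by rewrite (lt_le_trans (a0 i))// lerD2l ler_wpM2l.
rewrite -expR_sum ler_expR sumrN lerN2 -mulr_suml ler_wpM2r//.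
have aL i : a (lshift n2 i) =
    1 + delta * (2 * sig2 ^+ 2 - sig1 ^+ 2) * s%:R / (2 * sig2 ^+ 4).
  by rewrite /a /sg /= ltn_ord /theta; field.
have aR i : a (rshift n1 i) = 1 + delta * s%:R / (2 * sig2 ^+ 2).
  by rewrite /a /sg /= ltnNge leq_addr /= /theta; field.
rewrite big_split_ord/= (eq_bigr _ (fun i _ => congr1 (@ln R) (aL i))).
rewrite (eq_bigr _ (fun i _ => congr1 (@ln R) (aR i))) !sumr_const !card_ord.
by rewrite /error_exponent !mulr_natl.
Qed.

Let success := [set t | forall b : 'cV[R]_p, is_minimizer s (Y t) (X t) b ->
  (symdiff_card (supp bstar) (supp b))%:R < 2 * delta * s%:R].

Let bad (A : {set 'I_p}) := (#|A| == s) &&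
  (2 * delta * s%:R <= (symdiff_card (supp bstar) A)%:R :> R).

(** A failing minimizer is determined by its support, so failure is a finite union; both
    measurability and the union bound rest on this. *)
Lemma success_setC : ~` success =
  \bigcup_(A in [set A | bad A])
    [set t | is_minimizer s (Y t) (X t) (indicator_col A)].
Proof.
apply/seteqP; split => t.
  move=> /existsNP[b] /not_implyP[bmin /negP]; rewrite -leNgt => bbad.
  have bB := proj1 bmin; exists (supp b).
    by rewrite /= /bad (proj2 bB) eqxx.
  by rewrite /= -(indicator_col_supp bB).
move=> [A /= /andP[_ Abad] Amin] /(_ _ Amin); rewrite supp_indicator_col.
by move=> /(le_lt_trans Abad); rewrite ltxx.
Qed.

Lemma measurable_success : measurable success.
Proof.
rewrite -[success]setCK success_setC; apply: measurableC.
apply: fin_bigcup_measurable => // A /= /andP[/eqP As _].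
(* Minimality amounts to finitely many comparisons of measurable losses. *)
have -> : [set t | is_minimizer s (Y t) (X t) (indicator_col A)] =
    \bigcap_(A' in [set A' : {set 'I_p} | #|A'| == s])
      [set t | loss (Y t) (X t) (indicator_col A) <=
               loss (Y t) (X t) (indicator_col A')].
  apply/seteqP; split => t.
    by move=> [_ Amin] A' /= /eqP A's; apply: Amin; exact: in_B_indicator_col.
  move=> Amin; split; first exact: in_B_indicator_col.
  move=> b bB; rewrite (indicator_col_supp bB); apply: Amin => /=.
  by rewrite (proj2 bB).
by apply: fin_bigcap_measurable => // A' _; exact: measurable_loss_le.
Qed.

(** A minimizer has loss at most that of [bstar], so failure lies in the union of the events of
    [loss_le_prob] over the bad supports, of which there are at most ['C(p, s)]. *)
Lemma success_prob :
  ((1 - 'C(p, s)%:R * expR (- (error_exponent / 2)))%:E <= P success)%E.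
Proof.
rewrite -[success]setCK probability_setC; last first.
  by apply: measurableC; exact: measurable_success.
rewrite EFinB leeB//.
pose F A := [set t | loss (Y t) (X t) (indicator_col A) <=
                     loss (Y t) (X t) bstar].
apply: (@le_trans _ _ (P (\big[setU/set0]_(A | bad A) F A))).
  apply: le_measure; rewrite ?inE.
  - by apply: measurableC; exact: measurable_success.
  - by apply: bigsetU_measurable => A _; exact: measurable_loss_le.
  rewrite success_setC => t [A /= Abad [_ Amin]].
  by rewrite (bigD1 A)//=; left; exact: Amin.
apply: (le_trans
  (@union_bound _ _ _ P _ bad F (expR (- (error_exponent / 2))) _ _)).
- by move=> A; exact: measurable_loss_le.
- move=> A /andP[/eqP As Abad]; apply: loss_le_prob.
    exact: in_B_indicator_col.
  by rewrite supp_indicator_col.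
- rewrite lee_fin ler_wpM2r ?expR_ge0// ler_nat.
  rewrite -[p in 'C(p, s)]card_ord -card_draws; apply: subset_leq_card.
  by apply/fintype.subsetP => A /andP[As _]; rewrite inE.
Qed.

End error_probability.

(** * Entropy bounds on the number of supports *)

Section asymptotics.
Context {R : realType}.

(** At [x = s / p], the product of ['C(p, s)] and [exp (- p h(x))] is one term of the binomial
    expansion of [((1 - x) + x)^p = 1]. *)
Lemma binomial_le_expR_entropy (p s : nat) : (0 < s < p)%N ->
  'C(p, s)%:R <= expR (p%:R * bin_entropy (s%:R / p%:R)) :> R.
Proof.
move=> /andP[s0 sp]; set x : R := s%:R / p%:R.
have p0 : 0 < p%:R :> R by rewrite ltr0n (ltn_trans s0).
have x0 : 0 < x by rewrite divr_gt0// ltr0n.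
have x1 : 0 < 1 - x by rewrite subr_gt0 ltr_pdivrMr// mul1r ltr_nat.
have -> : expR (p%:R * bin_entropy x) = (x ^+ s * (1 - x) ^+ (p - s))^-1.
  have -> : p%:R * bin_entropy x =
      - (s%:R * ln x + (p - s)%:R * ln (1 - x)).
    rewrite /bin_entropy natrB ?(ltnW sp)//.
    have -> : s%:R = p%:R * x by rewrite mulrC divfK// gt_eqF.
    ring.
  by rewrite expRN expRD !expRM_natl !lnK.
rewrite -[leRHS]mul1r ler_pdivlMr; last by rewrite mulr_gt0// exprn_gt0.
have one : ((1 - x) + x) ^+ p = 1 by rewrite subrK expr1n.
rewrite -[leRHS]one [leRHS]exprDn; have sp' : (s < p.+1)%N by rewrite ltnS ltnW.
rewrite (bigD1 (Ordinal sp'))//= mulr_natl [x ^+ s * _]mulrC lerDl.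
rewrite sumr_ge0// => i _.
by rewrite mulrn_wge0// mulr_ge0// exprn_ge0// ltW.
Qed.

(** The first entropy term gives the logarithm; the second is at most [p x = s] because
    [- ln (1 - x) <= x / (1 - x)]. *)
Lemma entropy_le_ln (p s : nat) : (0 < s < p)%N ->
  p%:R * bin_entropy (s%:R / p%:R) <= s%:R * ln (p%:R / s%:R) + s%:R :> R.
Proof.
move=> /andP[s0 sp]; set x : R := s%:R / p%:R.
have p0 : 0 < p%:R :> R by rewrite ltr0n (ltn_trans s0).
have x0 : 0 < x by rewrite divr_gt0// ltr0n.
have x1 : 0 < 1 - x by rewrite subr_gt0 ltr_pdivrMr// mul1r ltr_nat.
have sE : s%:R = p%:R * x by rewrite mulrC divfK// gt_eqF.
have -> : ln (p%:R / s%:R) = - ln x by rewrite -lnV ?posrE// invf_div.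
have ln1x : - ln (1 - x) <= x / (1 - x).
  rewrite -lnV ?posrE//.
  rewrite -[X in ln X](_ : 1 + x / (1 - x) = (1 - x)^-1).
    by apply: le_ln1Dx; rewrite (lt_trans (ltrN10 _))// divr_gt0.
  by field; rewrite gt_eqF.
have : (1 - x) * - ln (1 - x) <= x.
  by rewrite mulrC -ler_pdivlMr.
rewrite -(ler_pM2l p0) sE /bin_entropy; lra.
Qed.

Lemma bin_entropy_gt0 (x : R) : 0 < x < 1 -> 0 < bin_entropy x.
Proof.
move=> /andP[x0 x1]; rewrite /bin_entropy mulNr -opprD oppr_gt0.
rewrite -(addr0 0) ltrD// pmulr_rlt0 ?subr_gt0// ln_lt0 ?x0 ?x1//.
by rewrite subr_gt0 x1 ltrBlDr ltrDl.
Qed.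

Lemma bin_entropy_cvg (u : nat -> R) (x : R) : 0 < x < 1 ->
  u @ \oo --> x -> (fun n => bin_entropy (u n)) @ \oo --> bin_entropy x.
Proof.
move=> /andP[x0 x1] ux.
have ux' : (fun n => 1 - u n) @ \oo --> 1 - x
  by apply: cvgB => //; exact: cvg_cst.
apply: cvgB; apply: cvgM => //.
- exact: cvgN.
- exact: (cvg_comp _ _ ux (continuous_ln x0)).
- by apply: (cvg_comp _ _ ux'); apply: continuous_ln; rewrite subr_gt0.
Qed.

(** Common interface to both regimes: [B] bounds the log-number of supports and is equivalent to
    [nstar / 2]. *)
Lemma regime_binomial (s : nat -> nat) (nstar : nat -> R) :
  regime s nstar -> exists B : nat -> R,
  [/\ \forall p \near \oo, 'C(p, s p)%:R <= expR (B p),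
      \forall p \near \oo, 0 < nstar p,
      (fun p => 2 * B p / nstar p) @ \oo --> (1 : R) &
      nstar @ \oo --> +oo].
Proof.
move=> [[u0 [soo ->]]|[alpha [a01 [ua ->]]]].
  have spos : \forall p \near \oo, (0 < s p)%N.
    move/cvgryPge : soo => /(_ 1); apply: filterS => p.
    by rewrite ler1n.
  have slt : \forall p \near \oo, (s p < p)%N.
    have u1 := cvgr_lt _ u0 _ ltr01; near=> p.
    have : (s p)%:R / p%:R < 1 :> R by near: p; exact: u1.
    have p0 : (0 < p)%N by near: p; exact: nbhs_infty_gt.
    by rewrite ltr_pdivrMr ?ltr0n// mul1r ltr_nat.
  have lnoo : (fun p => ln (p%:R / (s p)%:R) : R) @ \oo --> +oo.
    apply/cvgryPge => A.
    have ltA := cvgr_lt _ u0 _ (expR_gt0 (- A)); near=> p.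
    have uA : (s p)%:R / p%:R < expR (- A) by near: p; exact: ltA.
    have sp : (0 < s p)%N by near: p.
    have p0 : (0 < p)%N by near: p; exact: nbhs_infty_gt.
    have up : 0 < (s p)%:R / p%:R :> R by rewrite divr_gt0 ?ltr0n.
    rewrite -invf_div lnV ?posrE// lerNr ltW// -ltr_expR lnK//.
  have lnge : \forall p \near \oo, 1 <= ln (p%:R / (s p)%:R) :> R.
    by move/cvgryPge : lnoo; apply.
  (* With this choice [2 B / nstar = 1 + 1 / ln (p / s)], and the logarithm diverges. *)
  exists (fun p => (s p)%:R * ln (p%:R / (s p)%:R) + (s p)%:R); split.
  - near=> p; have sp : (0 < s p < p)%N by apply/andP; split; near: p.
    rewrite (le_trans (binomial_le_expR_entropy sp))// ler_expR.
    exact: entropy_le_ln.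
  - near=> p; rewrite !mulr_gt0 ?ltr0n//; first by near: p.
    by rewrite (lt_le_trans ltr01)//; near: p.
  - have lnV0 : (fun p => (ln (p%:R / (s p)%:R))^-1 : R) @ \oo --> (0 : R).
      apply/gtr0_cvgV0 => //; move: lnge; apply: filterS => p.
      exact: lt_le_trans.
    have : (fun p => 1 + (ln (p%:R / (s p)%:R))^-1 : R) @ \oo --> (1 + 0 : R).
      by apply: cvgD => //; exact: cvg_cst.
    rewrite addr0; apply: cvg_trans; apply: near_eq_cvg; near=> p.
    have l0 : ln (p%:R / (s p)%:R) != 0 :> R.
      by rewrite gt_eqF// (lt_le_trans ltr01)//; near: p.
    have s0 : (s p)%:R != 0 :> R by rewrite pnatr_eq0 -lt0n; near: p.
    by field; rewrite l0 s0.
  (* Once [ln (p / s) >= 1], [nstar] dominates [s]. *)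
  - apply: ger_cvgy soo; near=> p.
    have l1 : 1 <= ln (p%:R / (s p)%:R) :> R by near: p.
    have s0 : 0 <= (s p)%:R :> R by [].
    nra.
have /andP[a0 a1] := a01; have h0 := bin_entropy_gt0 a01.
have nsoo : (fun p => 2 * bin_entropy alpha * p%:R) @ \oo --> +oo.
  apply/cvgryPge => A; have /cvgryPge := @cvgr_idn R.
  move=> /(_ (A / (2 * bin_entropy alpha))); apply: filterS => p.
  by rewrite ler_pdivrMr ?mulr_gt0// mulrC.
(* Here [2 B / nstar = h(s / p) / h(alpha)], which tends to 1 by continuity of the entropy. *)
exists (fun p => p%:R * bin_entropy ((s p)%:R / p%:R)); split => //.
- have lt1 := cvgr_lt _ ua _ a1; have gt0 := cvgr_gt _ ua _ a0; near=> p.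
  have up : 0 < (s p)%:R / p%:R :> R by near: p; exact: gt0.
  have pu : (s p)%:R / p%:R < 1 :> R by near: p; exact: lt1.
  have p0 : (0 < p)%N by near: p; exact: nbhs_infty_gt.
  apply: binomial_le_expR_entropy; apply/andP; split.
    by move: up; rewrite pmulr_lgt0 ?invr_gt0 ltr0n.
  by move: pu; rewrite ltr_pdivrMr ?ltr0n// mul1r ltr_nat.
- by near=> p; rewrite !mulr_gt0// ltr0n; near: p; exact: nbhs_infty_gt.
- have : (fun p => bin_entropy ((s p)%:R / p%:R) / bin_entropy alpha) @ \oo
      --> (1 : R).
    rewrite -[X in _ --> X](divff (lt0r_neq0 h0)).
    by apply: cvgM; [exact: bin_entropy_cvg|exact: cvg_cst].
  apply: cvg_trans; apply: near_eq_cvg; near=> p.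
  have p0 : p%:R != 0 :> R.
    by rewrite pnatr_eq0 -lt0n; near: p; exact: nbhs_infty_gt.
  by field; rewrite p0 gt_eqF.
Unshelve. all: by end_near.
Qed.

End asymptotics.

(** * Asymptotic recovery guarantee *)

Theorem theorem1 (R : realType) (d : measure_display)
  (T : nat -> measurableType d) (P : forall p : nat, probability (T p) R)
  (s n1 n2 : nat -> nat) (sig1 sig2 : nat -> R)
  (bstar : forall p : nat, 'cV[R]_p)
  (X : forall p : nat, T p -> 'M[R]_(n1 p + n2 p, p))
  (W : forall p : nat, T p -> 'cV[R]_(n1 p + n2 p))
  (delta : R) (nstar : nat -> R) (eps : R) :
  (forall p, (0 < n1 p)%N /\ (0 < n2 p)%N) ->
  (forall p, 0 < sig1 p ^+ 2 < sig2 p ^+ 2) ->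
  (forall p, in_B (s p) (bstar p)) ->
  (forall p, gaussian_design (P p) (X p) (W p)) ->
  0 < delta < 1 ->
  regime s nstar ->
  0 < eps ->
  (\forall p \near \oo,
     (n1 p)%:R * ln (1 + delta * (2 * sig2 p ^+ 2 - sig1 p ^+ 2) * (s p)%:R
                           / (2 * sig2 p ^+ 4))
     + (n2 p)%:R * ln (1 + delta * (s p)%:R / (2 * sig2 p ^+ 2))
     >= (1 + eps) * nstar p) ->
  let success (p : nat) : set (T p) :=
    [set t | forall b : 'cV[R]_p,
       is_minimizer (s p)
         (response (sig1 p) (sig2 p) (X p t) (bstar p) (W p t)) (X p t) b ->
       (symdiff_card (supp (bstar p)) (supp b))%:R < 2 * delta * (s p)%:R] in
  exists r : nat -> R,
    r @ \oo --> (0 : R) /\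
    (\forall p \near \oo,
       ((1 - expR (- (eps + r p) * nstar p / 2))%:E <= P p (success p))%E) /\
    (fun p => P p (success p)) @ \oo --> (1%:E : \bar R).
Proof.
move=> _ sig12 bstarB XW /andP[/ltW delta0 _] reg eps0 hyp success.
have [B [CB ns0 B1 nsoo]] := regime_binomial reg.
(* Solves [B - (1 + eps) nstar / 2 = - (eps + r) nstar / 2], so [r] absorbs the union-bound loss. *)
pose r p := 1 - 2 * B p / nstar p.
have r0 : r @ \oo --> (0 : R).
  by rewrite -(subrr (1 : R)); apply: cvgB => //; exact: cvg_cst.
have lower : \forall p \near \oo,
    ((1 - expR (- (eps + r p) * nstar p / 2))%:E <= P p (success p))%E.
  near=> p.
  have nsp : 0 < nstar p by near: p.
  have CBp : 'C(p, s p)%:R <= expR (B p) by near: p.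
  have hypp : (1 + eps) * nstar p <=
      error_exponent (n1 p) (n2 p) (s p) (sig1 p) (sig2 p) delta by near: p.
  apply: le_trans (success_prob (sig12 p) (bstarB p) (XW p) delta0).
  rewrite lee_fin lerD2l lerN2.
  have -> : - (eps + r p) * nstar p / 2 = B p + - ((1 + eps) * nstar p / 2).
    by rewrite /r; field; rewrite gt_eqF.
  rewrite expRD ler_pM ?expR_ge0// ler_expR lerN2.
  by rewrite ler_pM2r// invr_gt0.
exists r; split => //; split => //.
(* Eventually [r > - eps / 2], so the exponent [(eps + r) nstar / 2] is at least [eps / 4 * nstar],
   which diverges. *)
pose low p := 1 - expR (- (eps / 4 * nstar p)).
have low1 : low @ \oo --> (1 : R).
  rewrite -[X in _ --> X](subr0 1); apply: cvgB; first exact: cvg_cst.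
  have epsn : (fun p => eps / 4 * nstar p) @ \oo --> +oo.
    apply/cvgryPge => A; move/cvgryPge : nsoo => /(_ (A / (eps / 4))).
    by apply: filterS => p; rewrite ler_pdivrMr ?divr_gt0// mulrC.
  exact: (cvg_comp _ _ epsn (@cvgr_expR R)).
apply: (@squeeze_cvge _ _ _ _ (EFin \o low) _ (cst 1%:E)); last exact: cvg_cst.
  near=> p; apply/andP; split; last first.
    by apply: probability_le1; exact: measurable_success (XW p) delta.
  have lowp : ((1 - expR (- (eps + r p) * nstar p / 2))%:E <=
               P p (success p))%E by near: p.
  apply: le_trans lowp; rewrite /= lee_fin lerD2l lerN2 ler_expR.
  have nsp : 0 < nstar p by near: p.
  have rp : - (eps / 2) < r p.
    by near: p; apply: (cvgr_gt _ r0); rewrite oppr_lt0 divr_gt0.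
  nra.
by apply: cvg_EFin; [exact: nearW|exact: low1].
Unshelve. all: by end_near.
Qed.
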